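(* Let $\mathcal G$ be a dual-compatible mesh. Then the set of functionals $\{\lambda_v: v\in\mathcal N_A\}$ is a set of dual functionals for the set $\{B_v: v\in\mathcal N_A\}$, i.e. $\lambda_v(B_w)=\delta_{vw}$ (Kronecker delta) for all $v,w\in\mathcal N_A$.
   Context: Parameters: $\mathbf p=(p_1,p_2,p_3)$ with each $p_i\ge 3$ an odd integer; $m\ge2$ an integer; positive integers $\tilde X,\tilde Y,\tilde Z$. Meshes: the initial mesh is $\mathcal G_0=\{[x-1,x]\times[y-1,y]\times[z-1,z] : x\in\{1,\dots,\tilde X\},y\in\{1,\dots,\tilde Y\},z\in\{1,\dots,\tilde Z\}\}$. The level of an element (closed axis-parallel box) $K$ is $\ell(K)=-\log_m|K|$ ($|K|$ = volume). Subdividing an element $K$ of a mesh means replacing it by the $m$ congruent boxes obtained by cutting $K$ by planes orthogonal to the $x$-axis if $\ell(K)\equiv0$, to the $y$-axis if $\ell(K)\equiv1$, to the $z$-axis if $\ell(K)\equiv2\pmod3$. A mesh $\mathcal G$ is a refinement of $\mathcal G_0$, i.e. obtained from $\mathcal G_0$ by finitely many successive element subdivisions. T-splines on a mesh $\mathcal G$: The nodes $\mathcal N$ are all vertices of all elements of $\mathcal G$. The active region is $\mathcal{AR}=[\lceil\frac{p_1}2\rceil,\tilde X-\lceil\frac{p_1}2\rceil]\times[\lceil\frac{p_2}2\rceil,\tilde Y-\lceil\frac{p_2}2\rceil]\times[\lceil\frac{p_3}2\rceil,\tilde Z-\lceil\frac{p_3}2\rceil]$, and $\mathcal N_A=\mathcal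 N\cap\mathcal{AR}$ is the set of active nodes. The $x$-orthogonal skeleton $\Xi_{\mathrm x}$ is the union of all closed element faces orthogonal to the $x$-axis, i.e. of the sets $\{x,x+\tilde x\}\times[y,y+\tilde y]\times[z,z+\tilde z]$ over all $[x,x+\tilde x]\times[y,y+\tilde y]\times[z,z+\tilde z]\in\mathcal G$; $\Xi_{\mathrm y},\Xi_{\mathrm z}$ are defined analogously. Global index sets: $\mathbf X(y,z)=\{\tilde x\in[0,\tilde X]:(\tilde x,y,z)\in\Xi_{\mathrm x}\}$, $\mathbf Y(x,z)=\{\tilde y\in[0,\tilde Y]:(x,\tilde y,z)\in\Xi_{\mathrm y}\}$, $\mathbf Z(x,y)=\{\tilde z\in[0,\tilde Z]:(x,y,\tilde z)\in\Xi_{\mathrm z}\}$. For $v=(v_1,v_2,v_3)\in\mathcal N_A$, the local index vector $\mathbf x(v)\in\mathbb R^{p_1+2}$ consists of the unique $p_1+2$ consecutive elements of $\mathbf X(v_2,v_3)$ having $v_1$ as middle ($\frac{p_1+3}2$-th) entry; $\mathbf y(v)\in\mathbb R^{p_2+2}$ and $\mathbf z(v)\in\mathbb R^{p_3+2}$ are defined analogously from $\mathbf Y(v_1,v_3)$, $\mathbf Z(v_1,v_2)$. The T-spline blending function is $B_v(x,y,z)=N_{\mathbf x(v)}(x)N_{\mathbf y(v)}(y)N_{\mathbf z(v)}(z)$, where $N_X$ is the (normalized) univariate B-spline of degree $p$ on the knot vector $X=(x_1,\dots,x_{p+2})$, $N_X(x)=(x_{p+2}-x_1)\,[x_1,\dots,x_{p+2}]\big((\bullet-x)_+^p\big)$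 with $[\cdot]$ the divided difference; the (closed) support $\operatorname{supp}B_v$ is the product of the closed intervals between first and last entries of the three local index vectors. Dual-compatibility: two index vectors $X=(x_1,\dots,x_{p+2})$ and $\tilde X=(\tilde x_1,\dots,\tilde x_{p+2})$ overlap if every $x\in\{x_1,\dots,x_{p+2}\}$ with $\tilde x_1\le x\le\tilde x_{p+2}$ belongs to $\{\tilde x_1,\dots,\tilde x_{p+2}\}$, and every $\tilde x\in\{\tilde x_1,\dots,\tilde x_{p+2}\}$ with $x_1\le\tilde x\le x_{p+2}$ belongs to $\{x_1,\dots,x_{p+2}\}$. Two nodes $v,w$ partially overlap if at least two of the three pairs $(\mathbf x(v),\mathbf x(w))$, $(\mathbf y(v),\mathbf y(w))$, $(\mathbf z(v),\mathbf z(w))$ overlap. A mesh is dual-compatible if any two active nodes $v,w\in\mathcal N_A$ with $|\operatorname{supp}B_v\cap\operatorname{supp}B_w|>0$ (positive volume) partially overlap. Functionals: for $p\ge1$ let $y_j=\cos\big(\tfrac{p-j+1}{p+1}\pi\big)$, $j=0,\dots,p+1$, and let $B^*_{p+1}(x)=(p+1)(-1)^{p+1}[y_0,\dots,y_{p+1}]\big((x-\bullet)_+^p\big)$ (divided difference in the variable $\bullet$) be the perfect B-spline. For an index vector $X=(x_1,\dots,x_{p+2})$ set, for $x_1\le x\le x_{p+2}$, $$G_X(x)=\int_{-1}^{\frac{2x-x_1-x_{p+2}}{x_{p+2}-x_1}}B^*_{p+1}(t)\,dt,\qquad \phi_X(x)=\tfrac1{p!}(x-x_2)\cdots(x-x_{p+1}),$$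 and for square-integrable $f$ $$\lambda_X(f)=\int_{x_1}^{x_{p+2}}f\,D^{p+1}(G_X\phi_X)\,dx .$$ For $v,w\in\mathcal N_A$ the functional $\lambda_v$ is given by $\lambda_v(B_w)=\lambda_{\mathbf x(v)}(N_{\mathbf x(w)})\cdot\lambda_{\mathbf y(v)}(N_{\mathbf y(w)})\cdot\lambda_{\mathbf z(v)}(N_{\mathbf z(w)})$. A known fact used by the paper (Schumaker, Theorem 4.41): if $X$ and $\tilde X$ overlap, then $\lambda_X(N_{\tilde X})=\delta_{X\tilde X}$. *)

(* Defs.v *)
From HB Require Import structures.
From mathcomp Require Import all_boot all_order all_algebra.
From mathcomp Require Import all_classical all_reals all_analysis.

Set Implicit Arguments.
Unset Strict Implicit.
Unset Printing Implicit Defensive.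

Import Order.TTheory GRing.Theory Num.Theory.
Import numFieldNormedType.Exports.

Local Open Scope classical_set_scope.
Local Open Scope ring_scope.

(* A point (x, y, z) of R^3 is nested to the left: x = q.1.1, y = q.1.2 and
   z = q.2. *)
Notation point3 R := (R * R * R)%type.

Definition volume3 (R : realType) (A : set (point3 R)) : \bar R :=
  ((lebesgue_measure \x lebesgue_measure) \x lebesgue_measure)%E
    (A : set (measurableTypeR R * measurableTypeR R * measurableTypeR R)).

(* An axis-parallel box is stored as the endpoint pairs of its three sides. *)
Record box (R : realType) := Box { xside : R * R; yside : R * R; zside : R * R }.

Definition between (R : realType) (I : R * R) (t : R) : Prop := I.1 <= t <= I.2.
Definition endpoint (R : realType) (I : R * R) (t : R) : Prop :=
  t = I.1 \/ t = I.2.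

Definition box_set (R : realType) (K : box R) : set (point3 R) :=
  [set q | [/\ between (xside K) q.1.1, between (yside K) q.1.2
             & between (zside K) q.2]].

Section Meshes.
Context {R : realType}.

Definition initial_mesh (X Y Z : nat) : set (box R) :=
  [set K | exists x y z : nat,
    [/\ (1 <= x <= X)%N, (1 <= y <= Y)%N, (1 <= z <= Z)%N
      & K = Box (x%:R - 1, x%:R) (y%:R - 1, y%:R) (z%:R - 1, z%:R)]].

Definition level (m : nat) (K : box R) : R :=
  - (ln (fine (volume3 (box_set K))) / ln m%:R).

Definition level_mod3 (m : nat) (K : box R) (i : nat) : Prop :=
  exists k : int, level m K = i%:R + 3 * k%:~R.

Definition part (m : nat) (I : R * R) (j : nat) : R * R :=
  (I.1 + j%:R * ((I.2 - I.1) / m%:R), I.1 + j.+1%:R * ((I.2 - I.1) / m%:R)).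

Definition cut_x (m : nat) (K : box R) : set (box R) :=
  [set Box (part m (xside K) j) (yside K) (zside K) | j in [set j | (j < m)%N]].
Definition cut_y (m : nat) (K : box R) : set (box R) :=
  [set Box (xside K) (part m (yside K) j) (zside K) | j in [set j | (j < m)%N]].
Definition cut_z (m : nat) (K : box R) : set (box R) :=
  [set Box (xside K) (yside K) (part m (zside K) j) | j in [set j | (j < m)%N]].

Inductive refinement (m X Y Z : nat) : set (box R) -> Prop :=
| Refine0 : refinement m X Y Z (initial_mesh X Y Z)
| RefineX G K : refinement m X Y Z G -> G K -> level_mod3 m K 0 ->
    refinement m X Y Z ((G `\ K) `|` cut_x m K)
| RefineY G K : refinement m X Y Z G -> G K -> level_mod3 m K 1 ->
    refinement m X Y Z ((G `\ K) `|` cut_y m K)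
| RefineZ G K : refinement m X Y Z G -> G K -> level_mod3 m K 2 ->
    refinement m X Y Z ((G `\ K) `|` cut_z m K).

Definition nodes (G : set (box R)) : set (point3 R) :=
  [set q | exists2 K, G K &
    [/\ endpoint (xside K) q.1.1, endpoint (yside K) q.1.2
      & endpoint (zside K) q.2]].

(* uphalf p is the ceiling of p / 2. *)
Definition active_region (p1 p2 p3 X Y Z : nat) : set (point3 R) :=
  [set q | [/\ (uphalf p1)%:R <= q.1.1 <= X%:R - (uphalf p1)%:R,
               (uphalf p2)%:R <= q.1.2 <= Y%:R - (uphalf p2)%:R
             & (uphalf p3)%:R <= q.2 <= Z%:R - (uphalf p3)%:R]].

Definition active_nodes (p1 p2 p3 X Y Z : nat) (G : set (box R)) :
  set (point3 R) := nodes G `&` active_region p1 p2 p3 X Y Z.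

Definition skeleton_x (G : set (box R)) : set (point3 R) :=
  [set q | exists2 K, G K &
    [/\ endpoint (xside K) q.1.1, between (yside K) q.1.2
      & between (zside K) q.2]].
Definition skeleton_y (G : set (box R)) : set (point3 R) :=
  [set q | exists2 K, G K &
    [/\ between (xside K) q.1.1, endpoint (yside K) q.1.2
      & between (zside K) q.2]].
Definition skeleton_z (G : set (box R)) : set (point3 R) :=
  [set q | exists2 K, G K &
    [/\ between (xside K) q.1.1, between (yside K) q.1.2
      & endpoint (zside K) q.2]].

Definition global_x (X : nat) (G : set (box R)) (y z : R) : set R :=
  [set t | 0 <= t <= X%:R /\ skeleton_x G (t, y, z)].
Definition global_y (Y : nat) (G : set (box R)) (x z : R) : set R :=
  [set t | 0 <= t <= Y%:R /\ skeleton_y G (x, t, z)].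
Definition global_z (Z : nat) (G : set (box R)) (x y : R) : set R :=
  [set t | 0 <= t <= Z%:R /\ skeleton_z G (x, y, t)].

End Meshes.

Section IndexVectors.
Context {R : realType}.

Definition first_knot (p : nat) (s : p.+2.-tuple R) : R := tnth s ord0.
Definition last_knot (p : nat) (s : p.+2.-tuple R) : R := tnth s ord_max.

(* For odd p the middle entry is the (p + 3) / 2-th one counted from 1, that
   is, the one at position p.+1./2 counted from 0. *)
Definition is_local_index (p : nat) (S : set R) (c : R) (s : p.+2.-tuple R) :
    Prop :=
  [/\ sorted <%R s,
      forall t, t \in s -> S t,
      forall t, S t -> first_knot s <= t <= last_knot s -> t \in s
    & nth 0 s p.+1./2 = c].

(* The default value of xget is never used at active nodes of a refinement of
   the initial mesh, where the local index vector exists and is unique. *)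
Definition local_index (p : nat) (S : set R) (c : R) : p.+2.-tuple R :=
  xget (nseq_tuple p.+2 c) [set s | is_local_index S c s].

Definition local_x (p1 X : nat) (G : set (box R)) (v : point3 R) :=
  local_index p1 (global_x X G v.1.2 v.2) v.1.1.
Definition local_y (p2 Y : nat) (G : set (box R)) (v : point3 R) :=
  local_index p2 (global_y Y G v.1.1 v.2) v.1.2.
Definition local_z (p3 Z : nat) (G : set (box R)) (v : point3 R) :=
  local_index p3 (global_z Z G v.1.1 v.1.2) v.2.

Definition overlap (p : nat) (s t : p.+2.-tuple R) : Prop :=
  (forall x, x \in s -> first_knot t <= x <= last_knot t -> x \in t) /\
  (forall x, x \in t -> first_knot s <= x <= last_knot s -> x \in s).

End IndexVectors.

Section Splines.
Context {R : realType}.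

(* divdiff_rec f s n i = [s_i, ..., s_(i+n)] f, for pairwise distinct knots. *)
Fixpoint divdiff_rec (f : R -> R) (s : seq R) (n i : nat) : R :=
  if n is n'.+1 then
    (divdiff_rec f s n' i.+1 - divdiff_rec f s n' i) / (s`_(i + n) - s`_i)
  else f s`_i.

Definition divdiff (s : seq R) (f : R -> R) : R :=
  divdiff_rec f s (size s).-1 0.

Definition pos_pow (p : nat) (t : R) : R := Num.max t 0 ^+ p.

Definition bspline (p : nat) (s : p.+2.-tuple R) (x : R) : R :=
  (last_knot s - first_knot s) * divdiff s (fun t => pos_pow p (t - x)).

Definition cos_knots (p : nat) : seq R :=
  mkseq (fun j => cos ((p.+1%:R - j%:R) / p.+1%:R * pi)) p.+2.

(* The perfect B-spline B*_(p+1). *)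
Definition perfect_bspline (p : nat) (x : R) : R :=
  p.+1%:R * (-1) ^+ p.+1 *
  divdiff (cos_knots p) (fun t => pos_pow p (x - t)).

Definition transition (p : nat) (s : p.+2.-tuple R) (x : R) : R :=
  \int[lebesgue_measure]_(t in
      `[-1, (2 * x - first_knot s - last_knot s) /
            (last_knot s - first_knot s)]) perfect_bspline p t.

Definition inner_poly (p : nat) (s : p.+2.-tuple R) (x : R) : R :=
  (p`!)%:R^-1 * \prod_(1 <= j < p.+1) (x - s`_j).

(* transition s * inner_poly s is p times continuously differentiable and
   piecewise polynomial, so its (p+1)-st derivative exists off a finite set;
   on that null set derive1n takes an irrelevant value. *)
Definition dual_functional (p : nat) (s : p.+2.-tuple R) (f : R -> R) : R :=
  \int[lebesgue_measure]_(x in `[first_knot s, last_knot s])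
    (f x * derive1n p.+1 (fun t => transition s t * inner_poly s t) x).

(* A tensor-product function keeps its three factors, so that the functionals
   lambda below can act factor by factor. *)
Record tensor3 := Tensor3 { xfactor : R -> R; yfactor : R -> R; zfactor : R -> R }.

Definition tensor3_fun (B : tensor3) (q : point3 R) : R :=
  xfactor B q.1.1 * yfactor B q.1.2 * zfactor B q.2.

End Splines.

Coercion tensor3_fun : tensor3 >-> Funclass.

Section TSplines.
Context {R : realType}.

Definition blending (p1 p2 p3 X Y Z : nat) (G : set (box R)) (v : point3 R) :
    tensor3 :=
  Tensor3 (bspline (local_x p1 X G v)) (bspline (local_y p2 Y G v))
          (bspline (local_z p3 Z G v)).

Definition blending_supp (p1 p2 p3 X Y Z : nat) (G : set (box R))
    (v : point3 R) : set (point3 R) :=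
  box_set (Box (first_knot (local_x p1 X G v), last_knot (local_x p1 X G v))
               (first_knot (local_y p2 Y G v), last_knot (local_y p2 Y G v))
               (first_knot (local_z p3 Z G v), last_knot (local_z p3 Z G v))).

Definition partially_overlap (p1 p2 p3 X Y Z : nat) (G : set (box R))
    (v w : point3 R) : Prop :=
  let ox := overlap (local_x p1 X G v) (local_x p1 X G w) in
  let oy := overlap (local_y p2 Y G v) (local_y p2 Y G w) in
  let oz := overlap (local_z p3 Z G v) (local_z p3 Z G w) in
  [\/ ox /\ oy, ox /\ oz | oy /\ oz].

Definition dual_compatible (p1 p2 p3 X Y Z : nat) (G : set (box R)) : Prop :=
  forall v w : point3 R,
    active_nodes p1 p2 p3 X Y Z G v -> active_nodes p1 p2 p3 X Y Z G w ->
    (0 < volume3 (blending_supp p1 p2 p3 X Y Z G v `&`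
                  blending_supp p1 p2 p3 X Y Z G w))%E ->
    partially_overlap p1 p2 p3 X Y Z G v w.

Definition lambda (p1 p2 p3 X Y Z : nat) (G : set (box R)) (v : point3 R)
    (B : tensor3) : R :=
  dual_functional (local_x p1 X G v) (xfactor B) *
  dual_functional (local_y p2 Y G v) (yfactor B) *
  dual_functional (local_z p3 Z G v) (zfactor B).

End TSplines.

(* Main.v *)
Require Import Defs.
From HB Require Import structures.
From mathcomp Require Import all_boot all_order all_algebra.
From mathcomp Require Import all_classical all_reals all_analysis.
From mathcomp Require Import ring lra zify.

Set Implicit Arguments.
Unset Strict Implicit.
Unset Printing Implicit Defensive.

Import Order.TTheory GRing.Theory Num.Theory.
Import numFieldNormedType.Exports.

Local Open Scope classical_set_scope.
Local Open Scope ring_scope.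

(** The functional of a knot vector s is built on F = G phi, where phi is the
    polynomial with zeros at the inner knots of s and the transition function
    G rises from 0 left of s to 1 right of s ([transition_left],
    [transition_right]). Since G is a combination of truncated powers of
    degree p + 1, Taylor's formula with integral remainder
    ([has_integral_truncated]) shows that the functional sends (sigma - x)_+^p
    to p! F(sigma) ([dual_functional_truncated_powers]). A B-spline is a
    divided difference of such truncated powers, so the functional of s sends
    the B-spline of t to the same divided difference of F, up to a factor
    ([dual_functional_bspline]). If s and t overlap and differ, then at the
    knots of t the values of F are either all 0 or all those of phi, whose
    degree is too low for the divided difference to be nonzero
    ([dual_functional_overlap]).

    For two distinct active nodes v and w one factor of the product has to
    vanish. If the supports do not meet in positive volume, then in some
    direction the supporting intervals have disjoint interiors; the two
    vectors then overlap and differ ([overlap_disjoint]). Otherwise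
    dual-compatibility gives overlap in two directions. If v and w differ in
    one of these two coordinates, then so do the middle entries of the
    vectors, and the factor vanishes. If they agree in both, then in the third
    direction they have the same global index set, from which overlap follows
    ([local_overlap]), while their third coordinates differ.

    All of this presupposes that the local index vectors of active nodes
    exist, which holds because coordinates stay finite in number under
    refinement and the planes of the initial grid stay in the skeletons
    ([local_x_index]). *)

(** * Integrals over the real line *)

Section Integral.
Context {R : realType}.
Implicit Types (f g : R -> R) (P : {poly R}).

(** Integrating over the whole line, with domains encoded in the integrand,
    makes all supports uniform; carrying integrability along makes the
    integral of a finite combination computable term by term. *)
Definition has_integral f (I : R) : Prop :=
  (@lebesgue_measure R).-integrable setT (EFin \o f) /\
  \int[lebesgue_measure]_x f x = I.

Lemma has_integral_restrict (D : set R) f I :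
  has_integral (f \_ D) I -> \int[lebesgue_measure]_(x in D) f x = I.
Proof. by case=> _; rewrite -Rintegral_mkcond. Qed.

Lemma eq_has_integral f g I : has_integral f I -> g =1 f -> has_integral g I.
Proof. by move=> fI /funext ->. Qed.

Lemma has_integralD f g I J : has_integral f I -> has_integral g J ->
  has_integral (fun x => f x + g x) (I + J).
Proof.
move=> [fi <-] [gi <-]; split; last by rewrite RintegralD.
by rewrite (_ : _ \o _ = (EFin \o f) \+ (EFin \o g))%E//; apply: integrableD.
Qed.

Lemma has_integralZ c f I : has_integral f I ->
  has_integral (fun x => c * f x) (c * I).
Proof.
move=> [fi <-]; split; last by rewrite RintegralZl.
rewrite (_ : _ \o _ = fun x => (c%:E * (EFin \o f) x))%E//.
exact: integrableZl.
Qed.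

Lemma has_integral0 : has_integral (fun=> 0) 0.
Proof.
split; last by rewrite Rintegral_cst// mul0r.
exact: integrable0.
Qed.

Lemma has_integral_sum n (f : nat -> R -> R) (I : nat -> R) :
  (forall i, (i < n)%N -> has_integral (f i) (I i)) ->
  has_integral (fun x => \sum_(i < n) f i x) (\sum_(i < n) I i).
Proof.
elim: n => [|n ih] h.
  under eq_fun do rewrite big_ord0.
  by rewrite big_ord0; exact: has_integral0.
under eq_fun do rewrite big_ord_recr/=.
rewrite big_ord_recr/=; apply: has_integralD; last exact: h.
by apply: ih => i ilt; apply: h; apply: ltnW.
Qed.

(** The fundamental theorem of calculus for a polynomial cut off outside [a,
    b]; the degenerate case [a = b] provides functions supported at one
    point. *)
Lemma has_integral_poly P a b : a <= b ->
  has_integral ((fun x => P^`().[x]) \_ `[a, b]) (P.[b] - P.[a]).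
Proof.
move=> ab; have cP : {within `[a, b], continuous (fun x => P^`().[x])}.
  by apply/continuous_subspaceT => x; exact: continuous_horner.
split.
  rewrite -restrict_EFin; apply: (iffLR (integrable_mkcond _ _)) => //.
  by apply: continuous_compact_integrable => //; exact: segment_compact.
rewrite -Rintegral_mkcond.
move: ab; rewrite le_eqVlt => /predU1P[<-|ab].
  by rewrite set_itv1 Rintegral_set1 subrr.
rewrite /Rintegral (@continuous_FTC2 _ _ (horner P))//.
  split=> [x _| |]; first exact: derivable_horner.
    by apply: cvg_at_right_filter; exact: continuous_horner.
  by apply: cvg_at_left_filter; exact: continuous_horner.
by move=> x _; rewrite derivE.
Qed.

(** Correcting an integrand at finitely many points adds functions that are
    supported at single points. This takes care of the knots, where iterated
    derivatives of a spline have uncontrolled values. *)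
Lemma has_integral_cofinite (l : seq R) f g I : has_integral f I ->
  (forall x, x \notin l -> g x = f x) -> has_integral g I.
Proof.
elim: l f => [|a l ih] f fI fg.
  by have -> : g = f by apply/funext => x; apply: fg.
(* The derivative of 'X cut off to [a, a] is the indicator function of a. *)
apply: (ih (fun x => f x + (g a - f a) *
    ((fun y => ('X : {poly R})^`().[y]) \_ `[a, a]) x)).
  have := has_integral_poly 'X (lexx a); rewrite subrr.
  move=> /(has_integralZ (g a - f a)) /(has_integralD fI).
  by rewrite mulr0 addr0.
move=> x xl; rewrite patchE set_itv1 derivX hornerC.
case: (eqVneq x a) => [->|xa].
  by rewrite ifT ?inE// mulr1 addrC subrK.
rewrite ifF ?mulr0 ?addr0; first by apply: fg; rewrite inE negb_or xa.
by apply/negP; rewrite inE /= => /eqP; rewrite (negPf xa).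
Qed.

End Integral.

(** * Divided differences *)

Section DividedDifferences.
Context {R : realType}.
Implicit Types (f g : R -> R) (s : seq R) (P : {poly R}).

Lemma eq_divdiff_rec f g s n i :
  (forall k, (i <= k <= i + n)%N -> f s`_k = g s`_k) ->
  divdiff_rec f s n i = divdiff_rec g s n i.
Proof.
elim: n i => [|n ih] i fg /=; first by apply: fg; lia.
by rewrite !ih// => k ?; apply: fg; lia.
Qed.

(** A divided difference is a fixed linear combination of the values at the
    knots, which reduces integrals of splines to those of truncated powers. *)
Lemma divdiff_recE s n i N : (i + n < N)%N -> exists w : nat -> R,
  forall f, divdiff_rec f s n i = \sum_(k < N) w k * f s`_k.
Proof.
elim: n i => [|n ih] i iN /=.
  exists (fun k => (k == i)%:R) => f; rewrite addn0 in iN.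
  rewrite (bigD1 (Ordinal iN))//= eqxx mul1r big1 ?addr0// => k.
  by rewrite -val_eqE/= => /negPf ->; rewrite mul0r.
have [|w0 w0E] := ih i; first by lia.
have [|w1 w1E] := ih i.+1; first by lia.
exists (fun k => (w1 k - w0 k) / (s`_(i + n.+1) - s`_i)) => f.
rewrite w0E w1E -sumrB mulr_suml; apply: eq_bigr => k _.
by rewrite -mulrBl mulrAC.
Qed.

(** When only the last value survives, the recursion has a single branch. *)
Lemma divdiff_rec_last f s n i :
  (forall k, (i <= k < i + n)%N -> f s`_k = 0) ->
  divdiff_rec f s n i = f s`_(i + n) / \prod_(k < n) (s`_(i + n) - s`_(i + k)).
Proof.
elim: n i => [|n ih] i f0 /=; first by rewrite big_ord0 addn0 divr1.
rewrite (ih i.+1); last by move=> k ?; apply: f0; lia.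
rewrite (ih i); last by move=> k ?; apply: f0; lia.
rewrite (f0 (i + n)%N) ?mul0r ?subr0; last by lia.
rewrite big_ord_recl/= invfM mulrA addn0 addSnnS mulrAC.
congr (_ / _ / _); by apply: eq_bigr => k _; rewrite addSnnS.
Qed.

Lemma divdiff_recD f g s n i :
  divdiff_rec (fun t => f t + g t) s n i =
  divdiff_rec f s n i + divdiff_rec g s n i.
Proof.
have [//|w wE] := @divdiff_recE s n i (i + n).+1.
by rewrite !wE -big_split; apply: eq_bigr => k _ /=; rewrite mulrDr.
Qed.

Lemma divdiff_recZ c f s n i :
  divdiff_rec (fun t => c * f t) s n i = c * divdiff_rec f s n i.
Proof.
have [//|w wE] := @divdiff_recE s n i (i + n).+1.
by rewrite !wE mulr_sumr; apply: eq_bigr => k _ /=; rewrite mulrCA.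
Qed.

Lemma divdiff_rec_cst c s n i : divdiff_rec (fun=> c) s n.+1 i = 0.
Proof.
elim: n i => [|n ih] i; first by rewrite /= subrr mul0r.
by move: (ih i) (ih i.+1) => /= -> ->; rewrite subrr mul0r.
Qed.

Lemma nth_sub_neq0 s i j : uniq s -> (i < j < size s)%N -> s`_j - s`_i != 0.
Proof.
move=> us /andP[ij js].
by rewrite subr_eq0 nth_uniq ?(gtn_eqF ij)//; exact: ltn_trans js.
Qed.

(** A special case of the Leibniz rule: a factor that vanishes at the first
    knot removes this knot. It drives the induction on the degree below. *)
Lemma divdiff_rec_root f s n i : uniq s -> (i + n.+1 < size s)%N ->
  divdiff_rec (fun t => (t - s`_i) * f t) s n.+1 i = divdiff_rec f s n i.+1.
Proof.
move=> us; elim: n i => [|n ih] i si.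
  rewrite /= subrr mul0r subr0 addn1 mulrAC divff ?mul1r//.
  by apply: nth_sub_neq0 => //; lia.
rewrite [LHS]/= -/(divdiff_rec _ s n.+1 i.+1) -/(divdiff_rec _ s n.+1 i).
rewrite (ih i); last by lia.
rewrite (@eq_divdiff_rec _
  (fun t => (t - s`_i.+1) * f t + (s`_i.+1 - s`_i) * f t)); last first.
  by move=> k _; rewrite -mulrDl addrA subrK.
have h : s`_(i + n.+2) - s`_i != 0 by apply: nth_sub_neq0 => //; lia.
have h' : s`_(i.+1 + n.+1) - s`_i.+1 != 0 by apply: nth_sub_neq0 => //; lia.
rewrite divdiff_recD divdiff_recZ ih; last by lia.
rewrite [divdiff_rec f s n.+1 i.+1]/=.
rewrite addSnnS in h' *; by field; rewrite h h'.
Qed.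

(** Splitting off P(s_i) leaves a multiple of X - s_i, so that each order of
    the difference lowers the degree by one. In particular a difference of
    order n annihilates the polynomials of degree less than n. *)
Lemma divdiff_rec_poly P s n i : uniq s -> (i + n < size s)%N ->
  (size P <= n.+1)%N -> divdiff_rec (horner P) s n i = P`_n.
Proof.
move=> us; elim: n i P => [|n ih] i P si sP.
  by rewrite /= [P]size1_polyC// hornerC coefC.
have /factor_theorem[q qE] : root (P - P.[s`_i]%:P) s`_i.
  by rewrite /root !hornerE subrr.
have PE : P = P.[s`_i]%:P + q * ('X - (s`_i)%:P) by rewrite -qE addrC subrK.
have sq : (size q <= n.+1)%N.
  rewrite -ltnS; have [->|q0] := eqVneq q 0; first by rewrite size_poly0.
  have <- : size (q * ('X - (s`_i)%:P)) = (size q).+1.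
    by rewrite size_Mmonic ?monicXsubC// size_XsubC addn2.
  rewrite -qE (leq_trans (size_polyD _ _))// geq_max sP.
  by rewrite size_polyN (leq_trans (size_polyC_leq1 _)).
rewrite (@eq_divdiff_rec _
  (fun t => P.[s`_i] + (t - s`_i) * q.[t])); last first.
  by move=> k _; rewrite {1}PE !hornerE mulrC.
rewrite divdiff_recD divdiff_rec_cst add0r divdiff_rec_root// ih//; last by lia.
rewrite PE coefD coefC/= add0r mulrBr coefB coefMX/= coefMC.
by rewrite [q`_n.+1]nth_default// mul0r subr0.
Qed.

End DividedDifferences.

(** * Taylor's formula and truncated powers *)

Section Taylor.
Context {R : realType}.
Implicit Types (q r : {poly R}).

(** The Taylor polynomial of q of degree p, evaluated at s, as a function of
    the expansion point. *)
Definition taylor_sum p (s : R) q : {poly R} :=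
  \sum_(n < p.+1) (n`!%:R)^-1 *: ((s%:P - 'X) ^+ n * q^`(n)).

(** The sum telescopes under differentiation, which makes [taylor_sum] an
    antiderivative of the kernel of the integral remainder. *)
Lemma deriv_taylor_sum p s q :
  (taylor_sum p s q)^`() = (p`!%:R)^-1 *: ((s%:P - 'X) ^+ p * q^`(p.+1)).
Proof.
have stepE n : ((n`!%:R)^-1 *: ((s%:P - 'X) ^+ n * q^`(n)))^`() =
    (n`!%:R)^-1 *: ((s%:P - 'X) ^+ n * q^`(n.+1)) -
    (if n is m.+1 then (m`!%:R)^-1 *: ((s%:P - 'X) ^+ m * q^`(n)) else 0).
  case: n => [|m]; first by rewrite !expr0 !mul1r subr0 derivZ derivnS.
  rewrite derivZ derivM deriv_exp derivB derivC derivX sub0r -derivnS /=.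
  rewrite mulN1r mulNrn mulNr mulrnAl scalerDr scalerN addrC.
  rewrite -[_ * _ *+ _]scaler_nat scalerA.
  congr (_ - _ *: _); rewrite factS natrM invfM mulrAC mulVf ?mul1r//.
elim: p => [|p ih]; rewrite /taylor_sum.
  by rewrite big_ord_recl big_ord0 addr0 stepE subr0.
by rewrite big_ord_recr/= derivD -/(taylor_sum p s q) ih stepE addrC subrK.
Qed.

Lemma horner_taylor_sum p s q : (taylor_sum p s q).[s] = q.[s].
Proof.
rewrite /taylor_sum big_ord_recl hornerD horner_sum big1 ?addr0 => [|i _].
  by rewrite /= fact0 invr1 scale1r expr0 mul1r.
by rewrite hornerZ hornerM horner_exp !hornerE subrr expr0n /= mulr0 mul0r.
Qed.

Lemma horner_derivn_factor a m n r : (n < m)%N ->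
  ((('X - a%:P) ^+ m * r)^`(n)).[a] = 0.
Proof.
elim: n m r => [|n ih] [|m] r // nm.
  by rewrite derivn0 !hornerE subrr expr0n mul0r.
rewrite derivSn derivM deriv_exp derivXsubC mul1r /=.
rewrite mulrnAl -mulrnAr exprSr -mulrA -mulrDr.
exact: ih.
Qed.

End Taylor.

Section TruncatedPowers.
Context {R : realType}.

Lemma pos_pow_ge0 p (t : R) : 0 <= t -> pos_pow p t = t ^+ p.
Proof. by move=> t0; rewrite /pos_pow max_l. Qed.

Lemma pos_pow_le0 p (t : R) : (0 < p)%N -> t <= 0 -> pos_pow p t = 0.
Proof. by move=> p0 t0; rewrite /pos_pow max_r// expr0n eqn0Ngt p0. Qed.

Lemma pos_powZ p (c t : R) : 0 <= c -> pos_pow p (c * t) = c ^+ p * pos_pow p t.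
Proof. by move=> c0; rewrite /pos_pow -exprMn maxr_pMr// mulr0. Qed.

Lemma has_integral_pos_pow p (a b : R) : (0 < p)%N ->
  has_integral (fun x => pos_pow p (x - a) * (x <= b)%R%:R)
    (p.+1%:R^-1 * pos_pow p.+1 (b - a)).
Proof.
move=> p0; have [ab|ba] := leP a b; last first.
  rewrite pos_pow_le0 ?subr_le0 ?(ltW ba)// mulr0.
  apply: (eq_has_integral has_integral0) => x.
  have [xb|_] := leP x b; last by rewrite mulr0.
  by rewrite pos_pow_le0 ?mul0r// subr_le0 (le_trans xb)// ltW.
pose P : {poly R} := p.+1%:R^-1 *: ('X - a%:P) ^+ p.+1.
have := has_integral_poly P ab.
have -> : P.[b] - P.[a] = p.+1%:R^-1 * pos_pow p.+1 (b - a).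
  by rewrite pos_pow_ge0 ?subr_ge0// !hornerE subrr expr0n mulr0 subr0.
move=> /eq_has_integral; apply => x.
rewrite patchE mem_setE in_itv/=.
have -> : P^`() = ('X - a%:P) ^+ p.
  rewrite derivZ deriv_exp derivXsubC mul1r /=.
  by rewrite -[_ ^+ _ *+ _]scaler_nat scalerA mulVf ?scale1r.
have [ax|xa] := leP a x; last by rewrite pos_pow_le0 ?mul0r// subr_le0 ltW.
have [xb|bx] := leP x b; last by rewrite mulr0.
by rewrite mulr1 pos_pow_ge0 ?subr_ge0// !hornerE.
Qed.

(** Taylor's formula with integral remainder for a polynomial q that vanishes
    at a to order p: the Taylor polynomial at a drops out, and the remainder
    alone gives q(s). Both sides vanish when s < a. *)
Lemma has_integral_truncated p (a s : R) (phi : {poly R}) : (0 < p)%N ->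
  let q := ('X - a%:P) ^+ p.+1 * phi in
  has_integral (fun x => pos_pow p (s - x) * ((a <= x)%R%:R * q^`(p.+1).[x]))
    (p`!%:R * (pos_pow p.+1 (s - a) * phi.[s])).
Proof.
move=> p0 q; have [as_|sa] := leP a s; last first.
  rewrite pos_pow_le0 ?subr_le0 ?(ltW sa)// mul0r mulr0.
  apply: (eq_has_integral has_integral0) => x.
  have [ax|_] := leP a x; last by rewrite mul0r mulr0.
  by rewrite pos_pow_le0 ?mul0r// subr_le0 (le_trans _ ax)// ltW.
have := has_integralZ p`!%:R (has_integral_poly (taylor_sum p s q) as_).
have -> : (taylor_sum p s q).[a] = 0.
  rewrite /taylor_sum horner_sum big1// => i _.
  by rewrite hornerZ hornerM horner_derivn_factor// !mulr0.
rewrite subr0 horner_taylor_sum {2}/q pos_pow_ge0 ?subr_ge0//.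
rewrite hornerM horner_exp hornerXsubC.
move=> /eq_has_integral; apply => x.
rewrite patchE mem_setE in_itv/= deriv_taylor_sum.
have [ax|xa] := leP a x; last by rewrite mul0r !mulr0.
have [xs|sx] := leP x s; last first.
  by rewrite pos_pow_le0 ?mul0r ?mulr0// subr_le0 ltW.
rewrite mul1r pos_pow_ge0 ?subr_ge0// hornerZ hornerM mulVKf.
  by rewrite !hornerE.
by rewrite pnatr_eq0 -lt0n fact_gt0.
Qed.

End TruncatedPowers.

(** * Knot vectors and the transition function *)

Section Knots.
Context {R : realType}.
Implicit Types (f g : R -> R) (P : {poly R}).

Lemma lt_sorted_nth (s : seq R) i j : sorted <%R s -> (i < j < size s)%N ->
  s`_i < s`_j.
Proof.
move=> ss /andP[ij js]; apply: (sorted_ltn_nth lt_trans) => //; rewrite ?inE//.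
exact: ltn_trans js.
Qed.

Lemma le_sorted_nth (s : seq R) i j : sorted <%R s -> (i <= j < size s)%N ->
  s`_i <= s`_j.
Proof.
move=> ss /andP[]; rewrite leq_eqVlt => /predU1P[->//|ij js].
by rewrite ltW// lt_sorted_nth// ij.
Qed.

Lemma divdiffE (s : seq R) n f : size s = n.+1 ->
  divdiff s f = divdiff_rec f s n 0.
Proof. by rewrite /divdiff => ->. Qed.

Lemma divdiff_weights (s : seq R) n : size s = n.+1 -> exists w : nat -> R,
  forall f, divdiff s f = \sum_(k < n.+1) w k * f s`_k.
Proof.
move=> sn; have [//|w wE] := @divdiff_recE R s n 0 n.+1.
by exists w => f; rewrite (divdiffE _ sn).
Qed.

Lemma eq_divdiff f g (s : seq R) n : size s = n.+1 -> {in s, f =1 g} ->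
  divdiff s f = divdiff s g.
Proof.
move=> sn fg; rewrite !(divdiffE _ sn); apply: eq_divdiff_rec => k kn.
by apply/fg/mem_nth; rewrite sn; lia.
Qed.

Lemma divdiff_poly P (s : seq R) n : uniq s -> size s = n.+1 ->
  (size P <= n.+1)%N -> divdiff s (horner P) = P`_n.
Proof. by move=> us sn sP; rewrite (divdiffE _ sn) divdiff_rec_poly// sn. Qed.

Section Bspline.
Variables (p : nat) (s : p.+2.-tuple R).
Hypothesis ss : sorted <%R s.

Lemma first_knotE : first_knot s = s`_0.
Proof. by rewrite /first_knot (tnth_nth 0). Qed.

Lemma last_knotE : last_knot s = s`_p.+1.
Proof. by rewrite /last_knot (tnth_nth 0). Qed.

Lemma uniq_knots : uniq s.
Proof. exact: sorted_uniq lt_trans ltxx _ ss. Qed.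

Lemma lt_first_last : first_knot s < last_knot s.
Proof. by rewrite first_knotE last_knotE lt_sorted_nth// size_tuple ltnSn. Qed.

Lemma first_knot_le x : x \in s -> first_knot s <= x.
Proof.
by move=> /(nthP 0)[k ks <-]; rewrite first_knotE le_sorted_nth.
Qed.

Lemma last_knot_ge x : x \in s -> x <= last_knot s.
Proof.
move=> /(nthP 0)[k ks <-]; rewrite last_knotE le_sorted_nth//.
by move: ks; rewrite size_tuple; lia.
Qed.

Lemma first_knot_mem : first_knot s \in s. Proof. exact: mem_tnth. Qed.
Lemma last_knot_mem : last_knot s \in s. Proof. exact: mem_tnth. Qed.

(** The affine map that takes the interval between the end knots to [-1,
    1]. *)
Let u x := (2 * x - first_knot s - last_knot s) / (last_knot s - first_knot s).

Let knots := cos_knots p : seq R.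

Lemma size_cos_knots : size knots = p.+2.
Proof. by rewrite size_mkseq. Qed.

(** The angles of the Chebyshev knots decrease from pi to 0. *)
Lemma cos_knots_sorted : sorted <%R knots.
Proof.
rewrite /knots /cos_knots /mkseq sorted_map.
apply: (@sub_in_sorted _ (mem (iota 0 p.+2)) ltn) (iota_ltn_sorted 0 p.+2);
  last first.
  exact/allP.
move=> i j; rewrite !mem_iota !add0n /= => ip jp ij.
have p0 : 0 < p.+1%:R :> R by rewrite ltr0n.
have itv k : (k < p.+2)%N -> (p.+1%:R - k%:R) / p.+1%:R * pi \in `[0, pi : R].
  move=> kp; rewrite in_itv/= -[X in _ && (_ <= X)]mul1r ler_pM2r ?pi_gt0//.
  rewrite ler_pdivrMr// mul1r lerBlDr lerDl ler0n andbT.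
  by rewrite mulr_ge0 ?pi_ge0// divr_ge0 ?ler0n// subr_ge0 ler_nat.
rewrite /= ltr_cos ?itv//.
rewrite ltr_pM2r ?pi_gt0// ltr_pM2r ?invr_gt0// ltrD2l ltrN2 ltr_nat //.
Qed.

Lemma cos_knots_itv y : y \in knots -> -1 <= y <= 1.
Proof.
by move=> /mapP[k _ ->]; rewrite cos_geN1 cos_le1.
Qed.

(** Integrating the truncated powers of the perfect B-spline one by one. They
    all vanish left of -1, where the integration starts, so the formula holds
    for every x, even where the interval of integration is empty. *)
Lemma transitionE x : (0 < p)%N -> transition s x =
  (-1) ^+ p.+1 * divdiff knots (fun y => pos_pow p.+1 (u x - y)).
Proof.
move=> p0; have [w wE] := divdiff_weights size_cos_knots.
apply: has_integral_restrict; rewrite wE mulr_sumr.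
have h k : (k < p.+2)%N -> has_integral
    (fun t => (p.+1%:R * (-1) ^+ p.+1 * w k) *
              (pos_pow p (t - knots`_k) * (t <= u x)%R%:R))
    ((-1) ^+ p.+1 * (w k * pos_pow p.+1 (u x - knots`_k))).
  move=> kp; have := has_integralZ (p.+1%:R * (-1) ^+ p.+1 * w k)
    (has_integral_pos_pow (knots`_k) (u x) p0).
  rewrite [X in has_integral _ X -> _](_ : _ =
    (-1) ^+ p.+1 * (w k * pos_pow p.+1 (u x - knots`_k)))//.
  by field.
have := has_integral_sum h; move=> /eq_has_integral; apply => t.
rewrite patchE mem_setE in_itv/= -/(u x).
have [tm1|tm1] := leP (-1) t; last first.
  rewrite big1// => k _; rewrite pos_pow_le0 ?mul0r ?mulr0// subr_le0.
  rewrite (le_trans (ltW tm1))//.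
  have : knots`_k \in knots by rewrite mem_nth// size_cos_knots.
  by move=> /cos_knots_itv/andP[].
have [tu|ut] := leP t (u x); last by rewrite big1// => k _; rewrite !mulr0.
rewrite /perfect_bspline wE mulr_sumr; apply: eq_bigr => k _.
by rewrite mulr1 mulrA.
Qed.

(** Left of the first knot every truncated power vanishes; right of the last
    knot they are all genuine powers, and the divided difference of order
    p + 1 of a polynomial of degree p + 1 is its leading coefficient. *)
Lemma transition_left x : (0 < p)%N -> x <= first_knot s -> transition s x = 0.
Proof.
move=> p0 xa; rewrite transitionE//.
have -> : divdiff knots (fun y => pos_pow p.+1 (u x - y)) =
    divdiff knots (horner 0).
  apply: (eq_divdiff size_cos_knots) => y /cos_knots_itv/andP[y1 _].
  rewrite pos_pow_le0 ?horner0// subr_le0 (le_trans _ y1)// /u.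
  rewrite ler_pdivrMr ?subr_gt0 ?lt_first_last//; lra.
rewrite (@divdiff_poly _ _ p.+1) ?size_poly0 ?size_cos_knots ?coef0 ?mulr0//.
exact: sorted_uniq lt_trans ltxx _ cos_knots_sorted.
Qed.

Lemma transition_right x : (0 < p)%N -> last_knot s <= x -> transition s x = 1.
Proof.
move=> p0 bx; rewrite transitionE//.
have -> : divdiff knots (fun y => pos_pow p.+1 (u x - y)) =
    divdiff knots (horner ((-1) ^+ p.+1 *: ('X - (u x)%:P) ^+ p.+1)).
  apply: (eq_divdiff size_cos_knots) => y /cos_knots_itv/andP[_ y1].
  rewrite pos_pow_ge0.
    by rewrite hornerZ horner_exp hornerXsubC -exprMn mulN1r opprB.
  rewrite subr_ge0 (le_trans y1)// /u.
  rewrite ler_pdivlMr ?subr_gt0 ?lt_first_last//; lra.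
have us : uniq knots by exact: sorted_uniq lt_trans ltxx _ cos_knots_sorted.
rewrite (@divdiff_poly _ _ p.+1) ?size_cos_knots//; last first.
  by rewrite (leq_trans (size_scale_leq _ _))// size_exp_XsubC.
have /monicP := monic_exp p.+1 (monicXsubC (u x)).
rewrite /lead_coef size_exp_XsubC/= coefZ => ->.
by rewrite mulr1 -exprMn mulrNN mulr1 expr1n.
Qed.

(** The form in which the transition function enters the integrals: knots that
    are not left of the support, and powers to which Taylor's formula
    applies. *)
Lemma transition_truncated_powers : (0 < p)%N -> exists (d tau : nat -> R),
  (forall j, (j < p.+2)%N -> first_knot s <= tau j) /\
  forall x, transition s x = \sum_(j < p.+2) d j * pos_pow p.+1 (x - tau j).
Proof.
move=> p0; have [w wE] := divdiff_weights size_cos_knots.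
have ab := lt_first_last.
set a := first_knot s in ab *; set b := last_knot s in ab.
have c0 : 0 <= 2 / (b - a) by rewrite divr_ge0// subr_ge0 ltW.
exists (fun j => (-1) ^+ p.+1 * w j * (2 / (b - a)) ^+ p.+1).
exists (fun j => a + (1 + knots`_j) * (b - a) / 2); split.
  move=> j jp; rewrite lerDl divr_ge0// mulr_ge0//; last first.
    by rewrite subr_ge0 ltW.
  have : knots`_j \in knots by rewrite mem_nth// size_cos_knots.
  by move=> /cos_knots_itv/andP[]; lra.
move=> x; rewrite transitionE// wE mulr_sumr; apply: eq_bigr => j _.
rewrite -!mulrA -pos_powZ//; congr (_ * (_ * pos_pow _ _)).
rewrite /u -/a -/b; field.
by rewrite subr_eq0 gt_eqF.
Qed.

End Bspline.
End Knots.

(** * Duality of overlapping B-splines *)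

Section DualFunctional.
Context {R : realType}.
Implicit Types (f : R -> R) (Q : {poly R}).

(** Iterated derivatives are local, so off its knots a piecewise polynomial
    can be differentiated like a polynomial. *)
Lemma near_derive1n_poly n f Q (x : R) : (\forall y \near x, f y = Q.[y]) ->
  \forall y \near x, derive1n n f y = Q^`(n).[y].
Proof.
move=> fQ; elim: n => [|n /near_join ih]; first by [].
apply: filterS ih => y fyQ; rewrite derive1nS derivnS derivE !derive1E.
exact: near_eq_derive.
Qed.

Lemma near_pos_pow p (a x : R) : (0 < p)%N -> x != a ->
  \forall y \near x, pos_pow p (y - a) = (a <= x)%R%:R * (y - a) ^+ p.
Proof.
move=> p0; rewrite neq_lt => /orP[xa|ax].
  rewrite leNgt xa /=; near=> y; rewrite mul0r pos_pow_le0// subr_le0 ltW//.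
  by near: y; exact: lt_nbhsl.
rewrite (ltW ax); near=> y; rewrite mul1r pos_pow_ge0// subr_ge0 ltW//.
by near: y; exact: lt_nbhsr.
Unshelve. all: by end_near. Qed.

Variables (p : nat) (s : p.+2.-tuple R).
Hypotheses (p0 : (0 < p)%N) (ss : sorted <%R s).

Definition interior_poly : {poly R} :=
  (p`!%:R)^-1 *: \prod_(1 <= j < p.+1) ('X - (s`_j)%:P).

Lemma inner_polyE x : inner_poly s x = interior_poly.[x].
Proof.
rewrite /inner_poly /interior_poly hornerZ horner_prod; congr (_ * _).
by apply: eq_bigr => j _; rewrite hornerXsubC.
Qed.

Lemma size_interior_poly : (size interior_poly <= p.+1)%N.
Proof.
rewrite (leq_trans (size_scale_leq _ _))//.
by rewrite size_prod_XsubC size_iota subn1.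
Qed.

Lemma inner_poly_root x : x \in s -> x != first_knot s -> x != last_knot s ->
  inner_poly s x = 0.
Proof.
move=> /(nthP 0)[k ks <-]; rewrite first_knotE last_knotE.
move: ks; rewrite size_tuple => ks.
have [->|k0] := eqVneq k 0%N; first by rewrite eqxx.
have [->|kp] := eqVneq k p.+1; first by rewrite eqxx.
move=> _ _; rewrite /inner_poly (bigD1_seq k) ?iota_uniq//=.
  by rewrite subrr mul0r mulr0.
by rewrite mem_index_iota; lia.
Qed.

(** Write F for [transition s] times [inner_poly s]. Off the knots tau, the
    derivative of F of order p + 1 is a combination of terms to which Taylor's
    formula applies, so each (sigma - x)_+^p integrates to p! F(sigma),
    provided that the domain of integration is the whole line. Indeed that
    derivative vanishes outside the support of s: on the left because no tau
    lies there, on the right because F is there a polynomial of degree p. *)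
Lemma dual_functional_truncated_powers N (c sigma : nat -> R) :
  dual_functional s (fun x => \sum_(k < N) c k * pos_pow p (sigma k - x)) =
  p`!%:R * \sum_(k < N) c k * (transition s (sigma k) * inner_poly s (sigma k)).
Proof.
have [d [tau [tau_ge trE]]] := transition_truncated_powers ss p0.
pose q j := ('X - (tau j)%:P) ^+ p.+1 * interior_poly.
pose D x := \sum_(j < p.+2) d j * ((tau j <= x)%R%:R * (q j)^`(p.+1).[x]).
have DE x : (forall j, (j < p.+2)%N -> x != tau j) ->
    \forall y \near x, transition s y * inner_poly s y =
      (\sum_(j < p.+2) (d j * (tau j <= x)%R%:R) *: q j).[y].
  move=> xtau; have : \forall y \near x, forall j : 'I_p.+2,
      pos_pow p.+1 (y - tau j) = (tau j <= x)%R%:R * (y - tau j) ^+ p.+1.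
    apply: (@filter_forall R 'I_p.+2 _ (nbhs x) (nbhs_filter x)) => j.
    by apply: near_pos_pow => //; exact: xtau.
  apply: filterS => y yE; rewrite trE inner_polyE mulr_suml horner_sum.
  apply: eq_bigr => j _.
  by rewrite yE [RHS]hornerZ hornerM horner_exp hornerXsubC !mulrA.
have DD x : (forall j, (j < p.+2)%N -> x != tau j) ->
    derive1n p.+1 (fun t => transition s t * inner_poly s t) x = D x.
  move=> /DE/(near_derive1n_poly p.+1)/nbhs_singleton ->.
  rewrite linear_sum horner_sum; apply: eq_bigr => j _.
  by rewrite linearZ hornerZ mulrA.
apply: has_integral_restrict.
have h k : (k < N)%N -> has_integral
    (fun x => c k * \sum_(j < p.+2) d j *
      (pos_pow p (sigma k - x) * ((tau j <= x)%R%:R * (q j)^`(p.+1).[x])))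
    (c k * \sum_(j < p.+2) d j *
      (p`!%:R * (pos_pow p.+1 (sigma k - tau j) * interior_poly.[sigma k]))).
  move=> _; apply: has_integralZ.
  apply: (has_integral_sum (f := fun j x => d j *
      (pos_pow p (sigma k - x) * ((tau j <= x)%R%:R * (q j)^`(p.+1).[x])))
    (I := fun j => d j *
      (p`!%:R * (pos_pow p.+1 (sigma k - tau j) * interior_poly.[sigma k])))).
  move=> j _.
  by apply: has_integralZ; exact: has_integral_truncated.
have := has_integral_sum h.
rewrite [X in has_integral _ X](_ : _ =
  p`!%:R * \sum_(k < N) c k *
    (transition s (sigma k) * inner_poly s (sigma k))); last first.
  rewrite mulr_sumr; apply: eq_bigr => k _.
  rewrite [RHS]mulrCA; congr (_ * _).
  rewrite trE inner_polyE mulr_suml mulr_sumr.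
  by apply: eq_bigr => j _; rewrite mulrCA -!mulrA.
move=> /(has_integral_cofinite
  (l := [:: first_knot s, last_knot s & [seq tau j | j <- iota 0 p.+2]])).
apply.
move=> x; rewrite in_cons negb_or in_cons negb_or => /and3P[xa xb xtau].
have {}xtau j : (j < p.+2)%N -> x != tau j.
  move=> jp; apply: contraNneq xtau => ->; apply: map_f.
  by rewrite mem_iota.
rewrite [RHS](_ : _ = (\sum_(k < N) c k * pos_pow p (sigma k - x)) * D x);
  last first.
  rewrite mulr_suml; apply: eq_bigr => k _; rewrite /D -mulrA; congr (_ * _).
  by rewrite mulr_sumr; apply: eq_bigr => j _; rewrite mulrCA.
rewrite patchE mem_setE.
rewrite (_ : (x \in _) = (first_knot s <= x <= last_knot s)); last first.
  by rewrite in_itv.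
case: (leP (first_knot s) x) => [ax|{}xa]; last first.
  rewrite (_ : D x = 0) ?mulr0// /D big1// => j _.
  by rewrite leNgt (lt_le_trans xa) /= ?mul0r ?mulr0// tau_ge.
case: (leP x (last_knot s)) => [_|bx]; rewrite andTb; first by rewrite DD.
rewrite -DD// (_ : derive1n _ _ x = 0) ?mulr0//.
have : \forall y \near x, transition s y * inner_poly s y = interior_poly.[y].
  near=> y; rewrite transition_right ?mul1r ?inner_polyE// ltW//.
  by near: y; exact: lt_nbhsr.
move=> /(near_derive1n_poly p.+1)/nbhs_singleton ->.
by rewrite derivn_poly0 ?horner0// size_interior_poly.
Unshelve. all: by end_near. Qed.

(** The B-spline is the Peano kernel of its divided difference. *)
Lemma dual_functional_bspline (t : p.+2.-tuple R) :
  dual_functional s (bspline t) = p`!%:R * ((last_knot t - first_knot t) *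
    divdiff t (fun x => transition s x * inner_poly s x)).
Proof.
have [w wE] := divdiff_weights (size_tuple t).
rewrite (_ : bspline t = fun x => \sum_(k < p.+2)
    ((last_knot t - first_knot t) * w k) * pos_pow p (t`_k - x)); last first.
  apply/funext => x; rewrite /bspline wE mulr_sumr.
  by apply: eq_bigr => k _; rewrite mulrA.
rewrite (dual_functional_truncated_powers _
  (fun k => (last_knot t - first_knot t) * w k) (fun k => t`_k)).
rewrite wE; congr (_ * _). rewrite [RHS]mulr_sumr.
by apply: eq_bigr => k _; rewrite -mulrA.
Qed.

(** The product vanishes at all knots of s except the last one, where its
    value and the denominator of the divided difference cancel. *)
Lemma dual_functional_bspline_diag : dual_functional s (bspline s) = 1.
Proof.
rewrite dual_functional_bspline (divdiffE _ (size_tuple s)) divdiff_rec_last.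
  rewrite add0n -last_knotE transition_right// mul1r big_ord_recl/=.
  rewrite -first_knotE.
  rewrite /inner_poly big_add1 /= big_mkord.
  have p0' : p`!%:R != 0 :> R by rewrite pnatr_eq0 -lt0n fact_gt0.
  have ab : last_knot s - first_knot s != 0.
    by rewrite subr_eq0 gt_eqF// lt_first_last.
  set A := \prod_(i < p) _.
  have A0 : A != 0.
    apply/prodf_neq0 => i _; rewrite subr_eq0 gt_eqF// last_knotE.
    by rewrite lt_sorted_nth// size_tuple; have := ltn_ord i; lia.
  by field; rewrite p0' ab A0.
move=> k kp; have ks : s`_k \in s by rewrite mem_nth// size_tuple; lia.
have [->|k0] := eqVneq k 0%N.
  by rewrite -first_knotE transition_left// mul0r.
have ak : s`_0 < s`_k by rewrite lt_sorted_nth// size_tuple; lia.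
have kb : s`_k < s`_p.+1 by rewrite lt_sorted_nth// size_tuple; lia.
by rewrite inner_poly_root ?mulr0// ?first_knotE ?last_knotE ?(gt_eqF ak)
  ?(lt_eqF kb).
Qed.

(** If the support of t contains that of s, overlap makes every knot of s a
    knot of t, and both vectors have the same number of knots. *)
Lemma overlap_spanning_eq (t : p.+2.-tuple R) : sorted <%R t -> overlap s t ->
  first_knot t <= first_knot s -> last_knot s <= last_knot t -> s = t.
Proof.
move=> st [sub _] ta tb.
have {}sub : {subset s <= t}.
  move=> x xs; apply: sub => //.
  by rewrite (le_trans ta) ?first_knot_le//= (le_trans _ tb)// last_knot_ge.
have [|_ eqst] := uniq_min_size (uniq_knots ss) sub.
  by rewrite !size_tuple.
apply/val_inj/(lt_sorted_eq ss st) => x.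
exact: eqst.
Qed.

(** Schumaker's duality. By overlap, the knots of t inside the support of s
    are knots of s, hence zeros of [inner_poly s] unless they are end knots.
    If t ends before the end of s, then the product that is differenced
    vanishes at all knots of t. If t starts after the start of s, it agrees
    there with [inner_poly s], whose degree is too low. Otherwise the two
    vectors agree. *)
Lemma dual_functional_overlap (t : p.+2.-tuple R) : sorted <%R t ->
  overlap s t -> dual_functional s (bspline t) = (s == t)%:R.
Proof.
move=> st ov; case: eqVneq => [<-|nst].
  exact: dual_functional_bspline_diag.
rewrite dual_functional_bspline.
have [tb|bt] := ltP (last_knot t) (last_knot s).
  rewrite (eq_divdiff (g := horner 0) (size_tuple t)).
    rewrite (@divdiff_poly _ _ _ p.+1) ?size_poly0 ?size_tuple ?uniq_knots//.
    by rewrite coef0 !mulr0.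
  move=> x xt; rewrite horner0; have [xa|ax] := leP x (first_knot s).
    by rewrite transition_left// mul0r.
  have xb := le_lt_trans (last_knot_ge st xt) tb.
  rewrite inner_poly_root ?mulr0 ?(gt_eqF ax) ?(lt_eqF xb)//.
  by apply: ov.2 => //; rewrite !ltW.
have [at_|ta] := ltP (first_knot s) (first_knot t).
  rewrite (eq_divdiff (g := horner interior_poly) (size_tuple t)).
    rewrite (@divdiff_poly _ _ _ p.+1) ?size_tuple ?uniq_knots//.
      by rewrite nth_default ?mulr0// size_interior_poly.
    exact: leq_trans size_interior_poly _.
  move=> x xt; have [bx|xb] := leP (last_knot s) x.
    by rewrite transition_right// mul1r inner_polyE.
  have ax := lt_le_trans at_ (first_knot_le st xt).
  rewrite -inner_polyE inner_poly_root ?mulr0 ?(gt_eqF ax) ?(lt_eqF xb)//.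
  by apply: ov.2 => //; rewrite !ltW.
by move: nst; rewrite (overlap_spanning_eq st ov ta bt) eqxx.
Qed.

End DualFunctional.

(** * Existence and overlap of local index vectors *)

Section LocalIndex.
Context {R : realType}.
Implicit Types (S : set R).

(** Vectors of consecutive elements of one set always overlap. *)
Lemma local_overlap p S c c' (s t : p.+2.-tuple R) :
  is_local_index S c s -> is_local_index S c' t -> overlap s t.
Proof.
move=> [_ sS Ss _] [_ tS St _]; split=> x xm xb.
  exact/St/xb/sS.
exact/Ss/xb/tS.
Qed.

(** When the interiors of the supports are disjoint, at most one point needs
    to be checked, and it is an end knot of both vectors. So
    [dual_functional_overlap] also covers supports that meet in a null set. *)
Lemma overlap_disjoint p (s t : p.+2.-tuple R) :
  sorted <%R s -> sorted <%R t ->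
  last_knot t <= first_knot s \/ last_knot s <= first_knot t ->
  overlap s t.
Proof.
move=> ss st h; split=> x xm /andP[ax xb].
  have := first_knot_le ss xm; have := last_knot_ge ss xm.
  case: h => h xb' ax'.
    by rewrite (_ : x = last_knot t) ?last_knot_mem//; apply/le_anti; lra.
  by rewrite (_ : x = first_knot t) ?first_knot_mem//; apply/le_anti; lra.
have := first_knot_le st xm; have := last_knot_ge st xm.
case: h => h xb' ax'.
  by rewrite (_ : x = first_knot s) ?first_knot_mem//; apply/le_anti; lra.
by rewrite (_ : x = last_knot s) ?last_knot_mem//; apply/le_anti; lra.
Qed.

(** The local index vector is the window of length p + 2 around c in the
    sorted enumeration of S; the lists [lo] and [hi] show that it does not
    stick out. *)
Lemma local_index_exists p S c (l lo hi : seq R) :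
  odd p -> (forall t, S t -> t \in l) -> S c ->
  uniq lo -> size lo = p.+1./2 -> {in lo, forall t, S t /\ t < c} ->
  uniq hi -> size hi = p.+1./2 -> {in hi, forall t, S t /\ c < t} ->
  is_local_index S c (local_index p S c).
Proof.
move=> op Sl Sc ulo; set n := p.+1./2 => nlo loS uhi nhi hiS.
have pn : p.+1 = (n + n)%N by rewrite addnn /n; lia.
have nE : p.+1./2 = n by [].
clearbody n.
suff [s hs] : exists s : p.+2.-tuple R, is_local_index S c s.
  by rewrite /local_index; apply: (@xgetPex _ (nseq_tuple p.+2 c)); exists s.
pose r := sort <=%R (undup [seq x <- l | `[< S x >]]).
have rS x : x \in r = `[< S x >].
  rewrite mem_sort mem_undup mem_filter andbC.
  by case: asboolP => [/Sl ->//|]; rewrite andbF.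
have rsorted : sorted <%R r.
  by rewrite lt_sorted_uniq_le sort_uniq undup_uniq/= sort_sorted.
set k := index c r.
have cr : c \in r by rewrite rS; exact/asboolP.
have kr : (k < size r)%N by rewrite index_mem.
have rk : r`_k = c by rewrite nth_index.
have nk : (n <= k)%N.
  rewrite -nlo -[k in leqRHS](@size_takel k _ r) ?(ltnW kr)//.
  apply: uniq_leq_size => // x /loS[Sx xc].
  have xr : x \in r by rewrite rS; exact/asboolP.
  rewrite in_take// ltnNge; apply/negP => kx.
  have := @le_sorted_nth _ r k (index x r) rsorted.
  by rewrite kx index_mem xr rk nth_index// leNgt xc => /(_ isT).
have kn : (k + n < size r)%N.
  have : (size hi <= size (drop k.+1 r))%N.
    apply: uniq_leq_size => // x /hiS[Sx cx].
    have xr : x \in r by rewrite rS; exact/asboolP.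
    have : x \in take k.+1 r ++ drop k.+1 r by rewrite cat_take_drop.
    rewrite mem_cat in_take// ltnS; case: (leqP (index x r) k) => // xk _.
    have := @le_sorted_nth _ r (index x r) k rsorted.
    by rewrite xk kr rk nth_index// leNgt cx => /(_ isT).
  by rewrite nhi size_drop; lia.
clearbody k.
pose s := take p.+2 (drop (k - n) r).
have ss : size s == p.+2.
  by rewrite size_takel// size_drop; lia.
have sE i : (i < p.+2)%N -> s`_i = r`_(k - n + i).
  by move=> ip; rewrite nth_take// nth_drop.
exists (Tuple ss); split => /=.
- exact/take_sorted/drop_sorted.
- by move=> t /mem_take/mem_drop; rewrite rS => /asboolP.
- move=> t St; rewrite first_knotE last_knotE/= !sE// addn0 => /andP[at_ tb].
  have tr : t \in r by rewrite rS; exact/asboolP.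
  have it : (index t r < size r)%N by rewrite index_mem.
  have i1 : (k - n <= index t r)%N.
    rewrite leqNgt; apply/negP => h.
    have := @lt_sorted_nth _ r (index t r) (k - n) rsorted.
    rewrite h nth_index// ltNge at_ (leq_ltn_trans (leq_subr n k) kr).
    by move=> /(_ isT).
  have i2 : (index t r <= k - n + p.+1)%N.
    rewrite leqNgt; apply/negP => h.
    have := @lt_sorted_nth _ r (k - n + p.+1) (index t r) rsorted.
    by rewrite h it nth_index// ltNge tb => /(_ isT).
  rewrite -(nth_index 0 tr).
  rewrite (_ : index t r = k - n + (index t r - (k - n)))%N; last by lia.
  rewrite -sE; last by lia.
  by apply: mem_nth; rewrite (eqP ss); lia.
- by rewrite -[uphalf p]/(p.+1./2) nE sE ?subnK//; lia.
Qed.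

End LocalIndex.

(** * Refinements of the initial mesh *)

Section Mesh.
Context {R : realType}.
Implicit Types (I : R * R) (K : box R) (G : set (box R)).

Lemma grid_cell (a h t : R) (N : nat) : (0 < N)%N -> a <= t <= a + N%:R * h ->
  exists2 j, (j < N)%N & a + j%:R * h <= t <= a + j.+1%:R * h.
Proof.
elim: N => [//|N ih] _ /andP[a_t tN].
have [Nt|tN'] := leP (a + N%:R * h) t; first by exists N; rewrite ?Nt.
have N0 : (0 < N)%N.
  by case: N tN' {ih tN} => [|//]; rewrite ltNge mul0r addr0 a_t.
have [|j jN jt] := ih N0; first by rewrite a_t ltW.
by exists j => //; exact: ltnW.
Qed.

(** A property of a point relative to an interval that is inherited by one of
    the parts whenever the interval is cut. Both ways of lying in a cell that
    define nodes and skeletons are of this kind, so skeletons can only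
    grow. *)
Definition persistent (m : nat) (A : R * R -> R -> Prop) : Prop :=
  forall I t, I.1 <= I.2 -> A I t -> exists2 j, (j < m)%N & A (part m I j) t.

Lemma persistent_endpoint m : (0 < m)%N -> persistent m (@endpoint R).
Proof.
move=> m0 I t _ [->|->].
  by exists 0%N => //; left; rewrite /part/= mul0r addr0.
exists m.-1; first by rewrite prednK.
right; rewrite /part/= prednK// mulrC divfK ?subrKC//.
by rewrite pnatr_eq0 -lt0n.
Qed.

Lemma persistent_between m : (0 < m)%N -> persistent m (@between R).
Proof.
move=> m0 I t I12 tI; apply: grid_cell => //.
by rewrite mulrC divfK ?subrKC// pnatr_eq0 -lt0n.
Qed.

Definition sides_ordered K : Prop :=
  [/\ (xside K).1 <= (xside K).2, (yside K).1 <= (yside K).2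
    & (zside K).1 <= (zside K).2].

Lemma part_ordered m I j : I.1 <= I.2 -> (part m I j).1 <= (part m I j).2.
Proof.
move=> I12; rewrite /part/= lerD2l ler_wpM2r ?ler_nat//.
by rewrite divr_ge0// subr_ge0.
Qed.

Lemma refinement_ordered m X Y Z G K :
  refinement m X Y Z G -> G K -> sides_ordered K.
Proof.
move=> hG; elim: hG K => {G}
  [|G K0 _ ih GK0 _|G K0 _ ih GK0 _|G K0 _ ih GK0 _] K.
- by move=> [x [y [z [_ _ _ ->]]]]; rewrite /sides_ordered/=; split; lra.
- move=> [[/ih//]|[j _ <-]]; case: (ih _ GK0) => *.
  by split=> //; exact: part_ordered.
- move=> [[/ih//]|[j _ <-]]; case: (ih _ GK0) => *.
  by split=> //; exact: part_ordered.
- move=> [[/ih//]|[j _ <-]]; case: (ih _ GK0) => *.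
  by split=> //; exact: part_ordered.
Qed.

(** Each of the three skeletons is an instance, up to conversion. *)
Definition cell_points (A B C : R * R -> R -> Prop) G : set (point3 R) :=
  [set q | exists2 K, G K &
    [/\ A (xside K) q.1.1, B (yside K) q.1.2 & C (zside K) q.2]].

Lemma cell_points_refinement m X Y Z A B C G q :
  persistent m A -> persistent m B -> persistent m C ->
  refinement m X Y Z G ->
  cell_points A B C (initial_mesh X Y Z) q -> cell_points A B C G q.
Proof.
move=> pA pB pC hG q0.
elim: hG => {G} [//|G K0 hG ih GK0 _|G K0 hG ih GK0 _|G K0 hG ih GK0 _];
  case: ih => K GK [a b c]; have [ox oy oz] := refinement_ordered hG GK;
  (have [KK0|KK0] := pselect (K = K0); last by exists K => //; left; split).
- have [j jm aj] := pA _ _ ox a.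
  exists (Box (part m (xside K) j) (yside K) (zside K)) => //.
  by right; exists j => //; rewrite KK0.
- have [j jm bj] := pB _ _ oy b.
  exists (Box (xside K) (part m (yside K) j) (zside K)) => //.
  by right; exists j => //; rewrite KK0.
- have [j jm cj] := pC _ _ oz c.
  exists (Box (xside K) (yside K) (part m (zside K) j)) => //.
  by right; exists j => //; rewrite KK0.
Qed.

(** One finite list of coordinates bounds the global index sets of all
    directions. *)
Lemma refinement_endpoints m X Y Z G : refinement m X Y Z G ->
  exists l : seq R, forall K t, G K ->
    [\/ endpoint (xside K) t, endpoint (yside K) t | endpoint (zside K) t] ->
    t \in l.
Proof.
have ends I m' : exists l : seq R, forall j t, (j < m')%N ->
    endpoint (part m I j) t -> t \in l.
  exists ([seq (part m I j).1 | j <- iota 0 m'] ++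
    [seq (part m I j).2 | j <- iota 0 m']).
  move=> j t jm [->|->]; rewrite mem_cat; apply/orP; [left|right];
    by apply: map_f; rewrite mem_iota.
elim=> {G} [|G K0 _ [l lP] GK0 _|G K0 _ [l lP] GK0 _|G K0 _ [l lP] GK0 _].
- pose N := (X + Y + Z)%N.
  exists ([seq i%:R - 1 | i <- iota 0 N.+1] ++ [seq i%:R | i <- iota 0 N.+1]).
  move=> _ t [x [y [z [hx hy hz ->]]]] /=.
  have hN k : (k <= N)%N -> endpoint (k%:R - 1, k%:R) t ->
      t \in [seq i%:R - 1 : R | i <- iota 0 N.+1] ++
        [seq i%:R | i <- iota 0 N.+1].
    move=> kN [->|->]; rewrite mem_cat; apply/orP; [left|right];
      by apply/mapP; exists k; rewrite // mem_iota.
  by case; apply: hN; rewrite /N; lia.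
- have [l' l'P] := ends (xside K0) m; exists (l ++ l') => K t.
  move=> [[GK _] /(lP K t GK) tl|[j jm <-]]; first by rewrite mem_cat tl.
  case=> /= ht; rewrite mem_cat; apply/orP; [right; exact: l'P ht|left|left];
    apply: lP GK0 _; by [apply: Or32|apply: Or33].
- have [l' l'P] := ends (yside K0) m; exists (l ++ l') => K t.
  move=> [[GK _] /(lP K t GK) tl|[j jm <-]]; first by rewrite mem_cat tl.
  case=> /= ht; rewrite mem_cat; apply/orP; [left|right; exact: l'P ht|left];
    apply: lP GK0 _; by [apply: Or31|apply: Or33].
- have [l' l'P] := ends (zside K0) m; exists (l ++ l') => K t.
  move=> [[GK _] /(lP K t GK) tl|[j jm <-]]; first by rewrite mem_cat tl.
  case=> /= ht; rewrite mem_cat; apply/orP; [left|left|right; exact: l'P ht];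
    apply: lP GK0 _; by [apply: Or31|apply: Or32].
Qed.

Lemma unit_between (N : nat) (t : R) : (0 < N)%N -> 0 <= t <= N%:R ->
  exists2 k : nat, (1 <= k <= N)%N & between (k%:R - 1, k%:R) t.
Proof.
move=> N0; rewrite -[N%:R]mulr1 -[N%:R * 1]add0r => /(grid_cell N0)[j jN].
rewrite !add0r !mulr1 => jt; exists j.+1 => //.
by rewrite /between/= -natr1 addrK natr1.
Qed.

Lemma unit_endpoint (N k : nat) : (0 < N)%N -> (k <= N)%N ->
  exists2 i : nat, (1 <= i <= N)%N & endpoint (i%:R - 1, i%:R) (k%:R : R).
Proof.
move=> N0; case: k => [|k] kN; first by exists 1%N => //; left; rewrite subrr.
by exists k.+1 => //; right.
Qed.

(** The grid points 0, 1, ... and N, N - 1, ... supply enough elements of S on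
    either side of any c in the active range. *)
Lemma local_index_grid p N (S : set R) c (l : seq R) : odd p ->
  (forall t, S t -> t \in l) -> S c ->
  (forall k : nat, (k <= N)%N -> S k%:R) ->
  (uphalf p)%:R <= c <= N%:R - (uphalf p)%:R ->
  is_local_index S c (local_index p S c).
Proof.
move=> op Sl Sc SN /andP[nc cn].
set n := uphalf p in nc cn.
have nN i : (i < n)%N -> (i <= N)%N.
  rewrite -(ltr_nat R) => ilt; rewrite -(ler_nat R).
  by have := ler0n R n; lra.
apply: (@local_index_exists _ p S c l [seq i%:R | i <- iota 0 n]
   [seq N%:R - i%:R | i <- iota 0 n]) => //.
- by rewrite map_inj_uniq ?iota_uniq// => i j /eqP; rewrite eqr_nat => /eqP.
- by rewrite size_map size_iota.
- move=> _ /mapP[i + ->]; rewrite mem_iota add0n => /= ilt; split.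
    exact/SN/nN.
  by move: ilt; rewrite -(ltr_nat R); lra.
- rewrite map_inj_uniq ?iota_uniq// => i j /(congr1 (fun x => N%:R - x)).
  by rewrite !subKr => /eqP; rewrite eqr_nat => /eqP.
- by rewrite size_map size_iota.
- move=> _ /mapP[i + ->]; rewrite mem_iota add0n => /= ilt; split.
    by rewrite -natrB ?nN//; apply: SN; rewrite leq_subr.
  by move: ilt; rewrite -(ltr_nat R); lra.
Qed.

End Mesh.

Section ActiveNodes.
Context {R : realType} (p1 p2 p3 m X Y Z : nat) (G : set (box R)).
Hypotheses (op1 : odd p1) (op2 : odd p2) (op3 : odd p3).
Hypotheses (m0 : (0 < m)%N) (X0 : (0 < X)%N) (Y0 : (0 < Y)%N) (Z0 : (0 < Z)%N).
Hypothesis hG : refinement m X Y Z G.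

Let active := active_nodes p1 p2 p3 X Y Z G.

Lemma endpoint_between (I : R * R) t :
  I.1 <= I.2 -> endpoint I t -> between I t.
Proof. by rewrite /between => h [->|->]; rewrite lexx h. Qed.

Lemma in_domain p N (t : R) :
  (uphalf p)%:R <= t <= N%:R - (uphalf p)%:R -> 0 <= t <= N%:R.
Proof. have := ler0n R (uphalf p); lra. Qed.

(** At an active node v, the coordinate lies in its own global index set
    because v is a corner of a cell, and the grid planes survive refinement.
    The same argument serves the three directions. *)
Lemma local_x_index v : active v ->
  is_local_index (global_x X G v.1.2 v.2) v.1.1 (local_x p1 X G v).
Proof.
move=> [[K GK [a b c]] [vx vy vz]].
have [_ oy oz] := refinement_ordered hG GK.
have [l lP] := refinement_endpoints hG.
apply: (local_index_grid (N := X) (l := l)) => //.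
- by move=> t [_ [K' GK' [ht _ _]]]; apply: lP GK' _; apply: Or31.
- split; first exact: in_domain vx.
  by exists K => //; split => //=; apply: endpoint_between.
- move=> k kX; split; first by rewrite ler0n ler_nat.
  apply: (cell_points_refinement
    (A := @endpoint R) (B := @between R) (C := @between R) _ _ _ hG);
    [exact: persistent_endpoint|exact: persistent_between
    |exact: persistent_between|].
  have [i iX hi] := unit_endpoint (R := R) X0 kX.
  have [j jY hj] := unit_between Y0 (in_domain vy).
  have [n nZ hn] := unit_between Z0 (in_domain vz).
  exists (Box (i%:R - 1, i%:R) (j%:R - 1, j%:R) (n%:R - 1, n%:R)) => //.
  by exists i, j, n.
Qed.

Lemma local_y_index v : active v ->
  is_local_index (global_y Y G v.1.1 v.2) v.1.2 (local_y p2 Y G v).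
Proof.
move=> [[K GK [a b c]] [vx vy vz]].
have [ox _ oz] := refinement_ordered hG GK.
have [l lP] := refinement_endpoints hG.
apply: (local_index_grid (N := Y) (l := l)) => //.
- by move=> t [_ [K' GK' [_ ht _]]]; apply: lP GK' _; apply: Or32.
- split; first exact: in_domain vy.
  by exists K => //; split => //=; apply: endpoint_between.
- move=> k kY; split; first by rewrite ler0n ler_nat.
  apply: (cell_points_refinement
    (A := @between R) (B := @endpoint R) (C := @between R) _ _ _ hG);
    [exact: persistent_between|exact: persistent_endpoint
    |exact: persistent_between|].
  have [i iX hi] := unit_between X0 (in_domain vx).
  have [j jY hj] := unit_endpoint (R := R) Y0 kY.
  have [n nZ hn] := unit_between Z0 (in_domain vz).
  exists (Box (i%:R - 1, i%:R) (j%:R - 1, j%:R) (n%:R - 1, n%:R)) => //.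
  by exists i, j, n.
Qed.

Lemma local_z_index v : active v ->
  is_local_index (global_z Z G v.1.1 v.1.2) v.2 (local_z p3 Z G v).
Proof.
move=> [[K GK [a b c]] [vx vy vz]].
have [ox oy _] := refinement_ordered hG GK.
have [l lP] := refinement_endpoints hG.
apply: (local_index_grid (N := Z) (l := l)) => //.
- by move=> t [_ [K' GK' [_ _ ht]]]; apply: lP GK' _; apply: Or33.
- split; first exact: in_domain vz.
  by exists K => //; split => //=; apply: endpoint_between.
- move=> k kZ; split; first by rewrite ler0n ler_nat.
  apply: (cell_points_refinement
    (A := @between R) (B := @between R) (C := @endpoint R) _ _ _ hG);
    [exact: persistent_between|exact: persistent_between
    |exact: persistent_endpoint|].
  have [i iX hi] := unit_between X0 (in_domain vx).
  have [j jY hj] := unit_between Y0 (in_domain vy).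
  have [n nZ hn] := unit_endpoint (R := R) Z0 kZ.
  exists (Box (i%:R - 1, i%:R) (j%:R - 1, j%:R) (n%:R - 1, n%:R)) => //.
  by exists i, j, n.
Qed.

End ActiveNodes.

(** * Volume of intersections of boxes *)

Section Volume.
Context {R : realType}.

Lemma volume3_box_gt0 (I J K : R * R) : I.1 < I.2 -> J.1 < J.2 -> K.1 < K.2 ->
  (0 < volume3 (box_set (Box I J K)))%E.
Proof.
move=> hI hJ hK.
have -> : box_set (Box I J K) =
    (`[I.1, I.2] `*` `[J.1, J.2]) `*` `[K.1, K.2].
  apply/seteqP; split => q /=; rewrite /box_set/= /between !in_itv/=.
    by move=> [].
  by move=> [[]].
pose mu := @lebesgue_measure R.
have -> : volume3 (`[I.1, I.2] `*` `[J.1, J.2] `*` `[K.1, K.2]) =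
    (mu `[I.1, I.2]%classic * mu `[J.1, J.2]%classic * mu `[K.1, K.2]%classic)%E.
  transitivity
      ((mu \x mu)%E (`[I.1, I.2] `*` `[J.1, J.2]) * mu `[K.1, K.2]%classic)%E.
    by apply: product_measure1E => //; exact: measurableX.
  by congr (_ * _)%E; apply: product_measure1E.
rewrite /mu !lebesgue_measure_itv/= !lte_fin hI hJ hK.
by rewrite !mule_gt0// -EFinB lte_fin subr_gt0.
Qed.

Lemma volume3_box_setI_gt0 (I J K I' J' K' : R * R) :
  Num.max I.1 I'.1 < Num.min I.2 I'.2 ->
  Num.max J.1 J'.1 < Num.min J.2 J'.2 ->
  Num.max K.1 K'.1 < Num.min K.2 K'.2 ->
  (0 < volume3 (box_set (Box I J K) `&` box_set (Box I' J' K')))%E.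
Proof.
move=> hI hJ hK.
suff -> : box_set (Box I J K) `&` box_set (Box I' J' K') =
    box_set (Box (Num.max I.1 I'.1, Num.min I.2 I'.2)
      (Num.max J.1 J'.1, Num.min J.2 J'.2)
      (Num.max K.1 K'.1, Num.min K.2 K'.2)).
  exact: volume3_box_gt0.
have btw (L L' : R * R) t : between (Num.max L.1 L'.1, Num.min L.2 L'.2) t <->
    between L t /\ between L' t.
  rewrite /between/= ge_max le_min; split.
    by move=> /andP[/andP[-> ->] /andP[-> ->]].
  by move=> [/andP[-> ->] /andP[-> ->]].
apply/seteqP; split=> q /=.
  by move=> [[x y z] [x' y' z']]; split => /=; apply/btw.
by move=> [/btw[x x'] /btw[y y'] /btw[z z']].
Qed.

End Volume.

(** * Duality of T-splines *)

Section OneDirection.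
Context {R : realType}.

Lemma local_index_sorted p S c (s : p.+2.-tuple R) : is_local_index S c s ->
  sorted <%R s.
Proof. by case. Qed.

Lemma local_index_middle p S S' c c' (s t : p.+2.-tuple R) :
  is_local_index S c s -> is_local_index S' c' t -> s = t -> c = c'.
Proof. by move=> [_ _ _ <-] [_ _ _ <-] ->. Qed.

(** The middle entries of the vectors tell nodes apart. *)
Lemma dual_functional_local_neq p S S' c c' (s t : p.+2.-tuple R) : (0 < p)%N ->
  is_local_index S c s -> is_local_index S' c' t -> overlap s t -> c <> c' ->
  dual_functional s (bspline t) = 0.
Proof.
move=> p0 hs ht ov cc'.
rewrite dual_functional_overlap ?(local_index_sorted hs)
  ?(local_index_sorted ht)//.
by case: eqVneq => // /(local_index_middle hs ht).
Qed.

Lemma dual_functional_disjoint p (s t : p.+2.-tuple R) : (0 < p)%N ->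
  sorted <%R s -> sorted <%R t ->
  Num.min (last_knot s) (last_knot t) <= Num.max (first_knot s) (first_knot t) ->
  dual_functional s (bspline t) = 0.
Proof.
move=> p0 ss st; have hs := lt_first_last ss; have ht := lt_first_last st.
move=> h; have {}h : last_knot t <= first_knot s \/ last_knot s <= first_knot t.
  move: h; rewrite ge_min !le_max => /orP[] /orP[]; lra.
rewrite dual_functional_overlap//; last exact: overlap_disjoint.
case: eqVneq => // st_; move: h; rewrite st_; lra.
Qed.

End OneDirection.

Lemma point3_eq (R : realType) (v w : point3 R) :
  v.1.1 = w.1.1 -> v.1.2 = w.1.2 -> v.2 = w.2 -> v = w.
Proof. by case: v w => -[? ?] ? [[? ?] ?] /= -> -> ->. Qed.

Theorem theorem6p7 (R : realType) (p1 p2 p3 m X Y Z : nat) (G : set (box R))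
    (hp1 : (3 <= p1)%N) (op1 : odd p1)
    (hp2 : (3 <= p2)%N) (op2 : odd p2)
    (hp3 : (3 <= p3)%N) (op3 : odd p3)
    (hm : (2 <= m)%N) (hX : (0 < X)%N) (hY : (0 < Y)%N) (hZ : (0 < Z)%N)
    (hG : refinement m X Y Z G)
    (hdual : dual_compatible p1 p2 p3 X Y Z G) :
  forall v w : point3 R,
    active_nodes p1 p2 p3 X Y Z G v -> active_nodes p1 p2 p3 X Y Z G w ->
    lambda p1 p2 p3 X Y Z G v (blending p1 p2 p3 X Y Z G w) =
      (v == w)%:R.
Proof.
move=> v w hv hw.
have p10 : (0 < p1)%N by exact: ltn_trans hp1.
have p20 : (0 < p2)%N by exact: ltn_trans hp2.
have p30 : (0 < p3)%N by exact: ltn_trans hp3.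
have m0 : (0 < m)%N by exact: ltn_trans hm.
have xv := local_x_index op1 m0 hX hY hZ hG hv.
have xw := local_x_index op1 m0 hX hY hZ hG hw.
have yv := local_y_index op2 m0 hX hY hZ hG hv.
have yw := local_y_index op2 m0 hX hY hZ hG hw.
have zv := local_z_index op3 m0 hX hY hZ hG hv.
have zw := local_z_index op3 m0 hX hY hZ hG hw.
rewrite /lambda /=.
have [<-|/eqP vw] := eqVneq v w.
  by rewrite !dual_functional_bspline_diag ?mulr1// ?(local_index_sorted xv)
    ?(local_index_sorted yv) ?(local_index_sorted zv).
have sx := local_index_sorted xv; have sx' := local_index_sorted xw.
have sy := local_index_sorted yv; have sy' := local_index_sorted yw.
have sz := local_index_sorted zv; have sz' := local_index_sorted zw.
have [dx|dx] := leP
    (Num.min (last_knot (local_x p1 X G v)) (last_knot (local_x p1 X G w)))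
    (Num.max (first_knot (local_x p1 X G v))
             (first_knot (local_x p1 X G w))).
  by rewrite (dual_functional_disjoint p10 sx sx' dx) !mul0r.
have [dy|dy] := leP
    (Num.min (last_knot (local_y p2 Y G v)) (last_knot (local_y p2 Y G w)))
    (Num.max (first_knot (local_y p2 Y G v))
             (first_knot (local_y p2 Y G w))).
  by rewrite (dual_functional_disjoint p20 sy sy' dy) mulr0 mul0r.
have [dz|dz] := leP
    (Num.min (last_knot (local_z p3 Z G v)) (last_knot (local_z p3 Z G w)))
    (Num.max (first_knot (local_z p3 Z G v))
             (first_knot (local_z p3 Z G w))).
  by rewrite (dual_functional_disjoint p30 sz sz' dz) mulr0.
(* From here on the supports meet in a box with interior points. *)
have po : partially_overlap p1 p2 p3 X Y Z G v w.
  by apply: hdual => //; apply: volume3_box_setI_gt0.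
have zx := dual_functional_local_neq p10 xv xw.
have zy := dual_functional_local_neq p20 yv yw.
have zz := dual_functional_local_neq p30 zv zw.
(* Nodes that share two coordinates have the same global index set in the third
   direction, so that their vectors also overlap there. *)
have ovx : v.1.2 = w.1.2 -> v.2 = w.2 ->
    overlap (local_x p1 X G v) (local_x p1 X G w).
  by move=> e2 e3; rewrite e2 e3 in xv; exact: local_overlap xv xw.
have ovy : v.1.1 = w.1.1 -> v.2 = w.2 ->
    overlap (local_y p2 Y G v) (local_y p2 Y G w).
  by move=> e1 e3; rewrite e1 e3 in yv; exact: local_overlap yv yw.
have ovz : v.1.1 = w.1.1 -> v.1.2 = w.1.2 ->
    overlap (local_z p3 Z G v) (local_z p3 Z G w).
  by move=> e1 e2; rewrite e1 e2 in zv; exact: local_overlap zv zw.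
have neq : v.1.1 <> w.1.1 \/ v.1.2 <> w.1.2 \/ v.2 <> w.2.
  have [e1|] := pselect (v.1.1 = w.1.1); last by left.
  have [e2|] := pselect (v.1.2 = w.1.2); last by right; left.
  by right; right => e3; apply: vw; exact: point3_eq.
suff : [\/ dual_functional (local_x p1 X G v) (bspline (local_x p1 X G w)) = 0,
   dual_functional (local_y p2 Y G v) (bspline (local_y p2 Y G w)) = 0 |
   dual_functional (local_z p3 Z G v) (bspline (local_z p3 Z G w)) = 0].
  by case=> ->; rewrite ?(mul0r, mulr0).
move: neq.
case: po => -[ov1 ov2].
- have [e1|/(zx ov1) ->] := pselect (v.1.1 = w.1.1); last by constructor 1.
  have [e2|/(zy ov2) ->] := pselect (v.1.2 = w.1.2); last by constructor 2.
  by case=> [ // | [ // | n3]]; constructor 3; exact: zz (ovz e1 e2) n3.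
- have [e1|/(zx ov1) ->] := pselect (v.1.1 = w.1.1); last by constructor 1.
  have [e3|/(zz ov2) ->] := pselect (v.2 = w.2); last by constructor 3.
  by case=> [ // | [n2 | // ]]; constructor 2; exact: zy (ovy e1 e3) n2.
- have [e2|/(zy ov1) ->] := pselect (v.1.2 = w.1.2); last by constructor 2.
  have [e3|/(zz ov2) ->] := pselect (v.2 = w.2); last by constructor 3.
  by case=> [n1 | [ // | // ]]; constructor 1; exact: zx (ovx e2 e3) n1.
Qed.
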